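(* In the signal detection model described in the context, let for $x>0$ $$I_{n,1,x}=\sum_{i=1}^{k_n}\varepsilon_{n,i}\,\mu_{n,i}\Bigl(\varepsilon_{n,i}\frac{d\mu_{n,i}}{dP_{n,i}}>x\Bigr),$$ $$I_{n,2,x}=\sum_{i=1}^{k_n}\varepsilon_{n,i}^2\,E_{P_{n,i}}\Bigl(\Bigl(\frac{d\mu_{n,i}}{dP_{n,i}}\Bigr)^2\mathbf 1\Bigl\{\varepsilon_{n,i}\frac{d\mu_{n,i}}{dP_{n,i}}\le x\Bigr\}-1\Bigr).$$ Let $\tau>0$ be fixed. Then: (a) The completely detectable case is present if and only if $I_{n,1,\tau}$ or $I_{n,2,\tau}$ tends to $\infty$ as $n\to\infty$. (b) The undetectable case is present if and only if $I_{n,1,\tau}$ as well as $I_{n,2,\tau}$ tends to $0$ as $n\to\infty$.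
   Context: Model: $k_n\in\mathbb N$ with $k_n\to\infty$. For each $n$ and $1\le i\le k_n$, $P_{n,i}$ (noise) and $\mu_{n,i}$ (signal) are probability measures on a common measurable space (which may depend on $n,i$) with $\mu_{n,i}\ll P_{n,i}$, and $\varepsilon_{n,i}\in[0,1]$ with $\max_{1\le i\le k_n}\varepsilon_{n,i}\to0$. Put $Q_{n,i}=(1-\varepsilon_{n,i})P_{n,i}+\varepsilon_{n,i}\mu_{n,i}$, $P_{(n)}=\bigotimes_{i=1}^{k_n}P_{n,i}$ (null), $Q_{(n)}=\bigotimes_{i=1}^{k_n}Q_{n,i}$ (alternative). The observations $Y_{n,i}$ are the coordinates, and $T_n=\sum_{i=1}^{k_n}\log\frac{dQ_{n,i}}{dP_{n,i}}(Y_{n,i})$ is the log-likelihood ratio statistic. Completely detectable case: there are critical values $c_n\in\mathbb R$ such that the tests $\varphi_n=\mathbf 1\{T_n>c_n\}$ satisfy $E_{P_{(n)}}(\varphi_n)+E_{Q_{(n)}}(1-\varphi_n)\to0$. Undetectable case: for every sequence of tests $\psi_n$ (measurable with values in $[0,1]$), $E_{P_{(n)}}(\psi_n)+E_{Q_{(n)}}(1-\psi_n)\to1$.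
   Formalization: In (a), ''I_{n,1,τ} or I_{n,2,τ} tends to ∞'' is taken as max(I_{n,1,τ}, I_{n,2,τ}) → ∞; as a disjunction of two limits the ''only if'' fails, e.g. when the two sums alternate in being large for even and odd n. *)

(* Defs.v *)
From HB Require Import structures.
From mathcomp Require Import all_boot all_order all_algebra.
From mathcomp Require Import all_classical all_reals all_analysis.

Set Implicit Arguments.
Unset Strict Implicit.
Unset Printing Implicit Defensive.
Import Order.TTheory GRing.Theory Num.Theory.
Import numFieldNormedType.Exports.

Local Open Scope classical_set_scope.
Local Open Scope ring_scope.
Local Open Scope ereal_scope.
Local Open Scope charge_scope.

Definition prod_space (k : nat) (d : 'I_k -> measure_display)
  (T : forall i, measurableType (d i)) : Type := forall i, T i.

Section prod_space.
Context (k : nat) (d : 'I_k -> measure_display).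
Variable T : forall i, measurableType (d i).

Definition coord_preimages : set (set (prod_space T)) :=
  [set B | exists i (A : set (T i)), measurable A /\ B = (fun y => y i) @^-1` A].

HB.instance Definition _ := gen_eqMixin (prod_space T).
HB.instance Definition _ := gen_choiceMixin (prod_space T).
HB.instance Definition _ := isPointed.Build (prod_space T) (fun=> point).

HB.instance Definition _ := @isMeasurable.Build default_measure_display
  (prod_space T) <<s coord_preimages >>
  (@sigma_algebra0 _ setT coord_preimages)
  (@sigma_algebraC _ coord_preimages)
  (@sigma_algebra_bigcup _ setT coord_preimages).

Lemma measurable_coord (i : 'I_k) :
  measurable_fun setT (fun y : prod_space T => y i).
Proof.
by move=> _ A mA; rewrite setTI; apply: sub_sigma_algebra; exists i, A.
Qed.

Lemma measurable_fun_coordP d0 (X : measurableType d0) (f : X -> prod_space T) :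
  (forall i, measurable_fun setT (fun x => f x i)) -> measurable_fun setT f.
Proof.
move=> mf; apply: (@measurability _ _ _ _ _ _ coord_preimages) => //.
by move=> _ [_ [i [A [mA ->]]] <-]; exact: mf.
Qed.

End prod_space.

Section cons_space.
Context (k : nat) (d : 'I_k.+1 -> measure_display).
Variable T : forall i, measurableType (d i).

Definition cons_space
    (z : T ord0 * prod_space (fun j : 'I_k => T (lift ord0 j))) :
    prod_space T :=
  fun i => match unliftP ord0 i with
           | UnliftSome j e => ecast i (T i) (esym e) (z.2 j)
           | UnliftNone e => ecast i (T i) (esym e) z.1
           end.

Lemma cons_space0 z : cons_space z ord0 = z.1.
Proof.
rewrite /cons_space; case: unliftP => [j e|e].
  by have /eqP := neq_lift ord0 j.
by rewrite (eq_irrelevance e erefl).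
Qed.

Lemma cons_spaceS z j : cons_space z (lift ord0 j) = z.2 j.
Proof.
rewrite /cons_space; case: unliftP => [j' e|e]; last first.
  by have /eqP[] := neq_lift ord0 j; exact: esym.
have ejj' := lift_inj e; case: j' / ejj' e => e.
by rewrite (eq_irrelevance e erefl).
Qed.

Lemma measurable_cons_space : measurable_fun setT cons_space.
Proof.
have m0 : measurable_fun setT (fun z => cons_space z ord0).
  rewrite (_ : (fun _ => _) = fst); first exact: measurable_fst.
  by apply/funext => z; rewrite cons_space0.
have mS (j : 'I_k) : measurable_fun setT (fun z => cons_space z (lift ord0 j)).
  have mj := @measurable_coord k _ (fun j => T (lift ord0 j)) j.
  apply: eq_measurable_fun (measurableT_comp mj measurable_snd) => z _.
  by rewrite cons_spaceS.
by apply: measurable_fun_coordP => i; case: (unliftP ord0 i) => [j|] ->.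
Qed.

HB.instance Definition _ :=
  isMeasurableFun.Build _ _ _ _ cons_space measurable_cons_space.

End cons_space.

Fixpoint prod_prob (R : realType) (k : nat) :
    forall (d : 'I_k -> measure_display) (T : forall i, measurableType (d i)),
    (forall i, probability (T i) R) -> probability (prod_space T) R :=
  match k with
  | 0 => fun d T P => dirac (point : prod_space T)
  | k'.+1 => fun d T P =>
      distribution (P ord0 \x prod_prob (fun j : 'I_k' => P (lift ord0 j)))
                   (@cons_space k' d T)
  end.

Lemma measurable_box (k : nat) (d : 'I_k -> measure_display)
    (T : forall i, measurableType (d i)) (A : forall i, set (T i)) :
  (forall i, measurable (A i)) ->
  measurable [set y : prod_space T | forall i, A i (y i)].
Proof.
move=> mA.
rewrite [X in measurable X](_ : _ =
    \bigcap_(i in setT) ((fun y : prod_space T => y i) @^-1` A i)); last first.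
  by apply/seteqP; split=> y /= H i //=; exact: H.
apply: fin_bigcap_measurable => // i _.
by rewrite -[X in measurable X]setTI; exact: measurable_coord.
Qed.

Lemma prod_prob_box (R : realType) (k : nat) (d : 'I_k -> measure_display)
    (T : forall i, measurableType (d i)) (P : forall i, probability (T i) R)
    (A : forall i, set (T i)) : (forall i, measurable (A i)) ->
  prod_prob P [set y | forall i, A i (y i)] = \prod_(i < k) P i (A i).
Proof.
elim: k d T P A => [|k IHk] d T P A mA /=.
  by rewrite big_ord0 diracE mem_set// => -[].
rewrite /distribution /pushforward.
rewrite [X in (_ \x _) X](_ : _ = A ord0 `*`
  [set y : prod_space (fun j : 'I_k => T (lift ord0 j)) |
    forall j, A (lift ord0 j) (y j)]); last first.
  apply/seteqP; split=> -[t y] /= H.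
    split; first by have := H ord0; rewrite cons_space0.
    by move=> j; have := H (lift ord0 j); rewrite cons_spaceS.
  case: H => H0 H1 i; case: (unliftP ord0 i) => [j|] ->.
    by rewrite cons_spaceS; exact: H1.
  by rewrite cons_space0.
have mB := @measurable_box k _ (fun j => T (lift ord0 j))
  (fun j => A (lift ord0 j)) (fun j => mA (lift ord0 j)).
rewrite product_measure1E// big_ord_recl; congr (_ * _).
exact: (IHk _ (fun j => T (lift ord0 j)) (fun j => P (lift ord0 j))
  (fun j => A (lift ord0 j)) (fun j => mA (lift ord0 j))).
Qed.

Section mixture.
Context d (T : measurableType d) (R : realType).
Variables (e : {i01 R}) (P mu : probability T R).

Definition mixture : set T -> \bar R :=
  measure_add (mscale (1 - e%:num)%:nng%R P) (mscale e%:num%:nng%R mu).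

HB.instance Definition _ := Measure.on mixture.

Let mixture_setT : mixture setT = 1.
Proof.
transitivity ((1 - e%:num)%:E * P setT + e%:num%:E * mu setT).
  by rewrite /mixture measure_addE.
by rewrite !probability_setT !mule1 -EFinD subrK.
Qed.

HB.instance Definition _ := Measure_isProbability.Build _ _ _ mixture mixture_setT.

Lemma mixture_dominates : mu `<< P -> mixture `<< P.
Proof.
move=> /null_content_dominatesP muP.
apply/null_content_dominatesP => A mA PA0.
transitivity ((1 - e%:num)%:E * P A + e%:num%:E * mu A).
  by rewrite /mixture measure_addE.
by rewrite PA0 muP// !mule0 adde0.
Qed.

End mixture.

(* Finite everywhere when [nu `<< P], but the version chosen by the library may
   be negative on a [P]-null set. *)
Definition density d (T : measurableType d) (R : realType)
  (nu P : probability T R) : T -> \bar R :=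
  'd (charge_of_finite_measure nu) '/d P.

Definition testing_error d (T : measurableType d) (R : realType)
  (P Q : probability T R) (psi : T -> R) : \bar R :=
  'E_P[psi] + 'E_Q[fun y => (1 - psi y)%R].

Section signal_detection.
Context (R : realType) (k : nat -> nat) (d : forall n, 'I_(k n) -> measure_display).
Context (T : forall n (i : 'I_(k n)), measurableType (d i)).
Variables (P mu : forall n (i : 'I_(k n)), probability (T i) R).
Variable eps : forall n, 'I_(k n) -> {i01 R}.
Arguments P {n}.
Arguments mu {n}.
Arguments eps {n}.
Implicit Types (n : nat) (x : R).

Definition null n : probability (prod_space (T (n := n))) R :=
  prod_prob P.

Definition signal_marginal n (i : 'I_(k n)) : probability (T i) R :=
  mixture (eps i) (P i) (mu i).

Definition alternative n : probability (prod_space (T (n := n))) R :=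
  prod_prob (@signal_marginal n).

(* [lne] sends nonpositive values to [-oo]; when every [mu i `<< P i], no term
   is [+oo] by [mixture_dominates], so that the sum is well defined. *)
Definition log_likelihood_ratio n (y : prod_space (T (n := n))) : \bar R :=
  \sum_(i < k n) lne (density (signal_marginal i) (P i) (y i)).

Definition completely_detectable : Prop :=
  exists c : nat -> R,
    testing_error (null n) (alternative n)
      \1_[set y | (c n)%:E < log_likelihood_ratio y] @[n --> \oo] --> 0.

Definition undetectable : Prop :=
  forall psi : forall n, prod_space (T (n := n)) -> R,
    (forall n, measurable_fun setT (psi n)) ->
    (forall n y, (0 <= psi n y <= 1)%R) ->
    testing_error (null n) (alternative n) (psi n) @[n --> \oo] --> 1.

(* Here and in [signal2], an index with [eps i = 0] contributes [0]. *)
Definition signal1 n x : \bar R :=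
  \sum_(i < k n) (eps i)%:num%:E *
    mu i [set t | x%:E < (eps i)%:num%:E * density (mu i) (P i) t].

Definition signal2 n x : \bar R :=
  \sum_(i < k n) ((eps i)%:num ^+ 2)%:E *
    \int[P i]_t
      (density (mu i) (P i) t ^+ 2 *
       (\1_[set t | ((eps i)%:num%:E * density (mu i) (P i) t <= x%:E)%E] t)%:E - 1).

End signal_detection.

(* Main.v *)
Require Import Defs.
From HB Require Import structures.
From mathcomp Require Import all_boot all_order all_algebra.
From mathcomp Require Import all_classical all_reals all_analysis.
From mathcomp Require Import measurable_realfun ring lra.

(* Everything is controlled by the Hellinger affinity A_n = E_{P_(n)} sqrt(L_n),
   where L_n is the likelihood ratio of Q_(n) to P_(n).  Every test with total
   error e satisfies A_n^2 <= 2 e and (1 - e)^2 <= 8 (1 - A_n), while the test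
   {T_n > 0} has error at most A_n; hence complete detectability means A_n -> 0
   and undetectability means A_n -> 1.  The affinity is the product over i of the
   marginal affinities, and a pointwise comparison of (1 - sqrt(dQ/dP))^2 with the
   integrands of the two signals gives, as soon as all eps are small,
   exp(- C (I_1 + I_2)) <= A_n <= exp(- c (I_1 + I_2)) with constants that depend
   only on tau.  As also I_2 >= - I_1 / 2, the sum I_1 + I_2 tends to 0 or to
   infinity exactly when the signals do in the sense of the theorem. *)

Set Implicit Arguments.
Unset Strict Implicit.
Unset Printing Implicit Defensive.
Import Order.TTheory GRing.Theory Num.Theory.
Import numFieldNormedType.Exports.

Local Open Scope classical_set_scope.
Local Open Scope ring_scope.

(** * Likelihood ratios of product measures *)

(** Change of variables is asked for all nonnegative [f], not only for indicators, so that a product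
    density can be checked one coordinate at a time inside an iterated integral. *)
Definition is_density d (T : measurableType d) (R : realType)
    (P Q : probability T R) (g : T -> R) : Prop :=
  [/\ measurable_fun setT g, (forall t, 0 <= g t) &
    forall f : T -> \bar R, measurable_fun [set: T] f -> (forall t, 0 <= f t)%E ->
      (\int[Q]_t f t = \int[P]_t (f t * (g t)%:E))%E].

Section product.
Context (R : realType).

Lemma measurable_prod_coord (k : nat) (d : 'I_k -> measure_display)
    (T : forall i, measurableType (d i)) (g : forall i, T i -> R) :
  (forall i, measurable_fun setT (g i)) ->
  measurable_fun setT (fun y : prod_space T => \prod_(i < k) g i (y i)).
Proof.
move=> mg; apply: measurable_prod => i _.
exact: (measurableT_comp (mg i) (@measurable_coord _ _ T i)).
Qed.

Lemma ge0_integral_prod_probS (k : nat) (d : 'I_k.+1 -> measure_display)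
    (T : forall i, measurableType (d i)) (P : forall i, probability (T i) R)
    (f : prod_space T -> \bar R) :
  measurable_fun [set: prod_space T] f -> (forall y, 0 <= f y)%E ->
  (\int[prod_prob P]_y f y =
   \int[P ord0]_x \int[prod_prob (fun j : 'I_k => P (lift ord0 j))]_z
     f (cons_space (x, z)))%E.
Proof.
move=> mf f0 /=; rewrite ge0_integral_distribution//.
rewrite fubini_tonelli1//; last by move=> z; exact: f0.
exact: (measurableT_comp mf (@measurable_cons_space _ _ T)).
Qed.

(** Applied to square roots of marginal likelihood ratios, this makes the affinity multiplicative.
    Tonelli splits off the first coordinate, and induction turns the inner integral into a constant
    factor. *)
Lemma ge0_integral_prod_coord (k : nat) (d : 'I_k -> measure_display)
    (T : forall i, measurableType (d i)) (P : forall i, probability (T i) R)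
    (g : forall i, T i -> R) (a : 'I_k -> R) :
  (forall i, measurable_fun setT (g i)) -> (forall i t, 0 <= g i t) ->
  (forall i, \int[P i]_t (g i t)%:E = (a i)%:E)%E ->
  (\int[prod_prob P]_y (\prod_(i < k) g i (y i))%:E = (\prod_(i < k) a i)%:E)%E.
Proof.
elim: k d T P g a => [|k IHk] d T P g a mg g0 ga.
  under eq_integral do rewrite big_ord0.
  rewrite integral_cst// big_ord0 mul1e.
  exact: (probability_setT (prod_prob P)).
rewrite ge0_integral_prod_probS; last 2 first.
- by apply/measurable_EFinP; exact: measurable_prod_coord.
- by move=> y; rewrite lee_fin; apply: prodr_ge0.
have mg' j := mg (lift ord0 j).
have IH := IHk _ (fun j => T (lift ord0 j)) (fun j => P (lift ord0 j))
  (fun j => g (lift ord0 j)) (fun j => a (lift ord0 j)) mg'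
  (fun j => g0 _) (fun j => ga _).
transitivity (\int[P ord0]_x ((g ord0 x)%:E * (\prod_(j < k) a (lift ord0 j))%:E))%E.
  apply: eq_integral => x _.
  rewrite -IH -ge0_integralZl//.
  - apply: eq_integral => z _; rewrite big_ord_recl cons_space0 -EFinM.
    by congr (_ * _)%:E; apply: eq_bigr => j _; rewrite cons_spaceS.
  - apply/measurable_EFinP.
    exact: (@measurable_prod_coord k _ (fun j => T (lift ord0 j)) _ mg').
  - by move=> z _; rewrite lee_fin; apply: prodr_ge0.
  - by rewrite lee_fin.
rewrite ge0_integralZr//.
- by rewrite ga big_ord_recl.
- exact/measurable_EFinP.
- by move=> x _; rewrite lee_fin.
- by rewrite -IH integral_ge0// => z _; rewrite lee_fin; apply: prodr_ge0.
Qed.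

Lemma is_density_prod (k : nat) (d : 'I_k -> measure_display)
    (T : forall i, measurableType (d i)) (P Q : forall i, probability (T i) R)
    (g : forall i, T i -> R) :
  (forall i, is_density (P i) (Q i) (g i)) ->
  is_density (prod_prob P) (prod_prob Q) (fun y => \prod_(i < k) g i (y i)).
Proof.
move=> gd; split.
- by apply: measurable_prod_coord => i; have [] := gd i.
- by move=> y; apply: prodr_ge0 => i _; have [] := gd i.
elim: k d T P Q g gd => [|k IHk] d T P Q g gd f mf f0.
  by apply: eq_integral => y _; rewrite big_ord0 mule1.
have mg i : measurable_fun setT (g i) by have [] := gd i.
have g0 i t : 0 <= g i t by have [] := gd i.
have mG : measurable_fun setT (fun y : prod_space T => \prod_(i < k.+1) g i (y i)).
  exact: measurable_prod_coord.
have mG' := @measurable_prod_coord k _ (fun j => T (lift ord0 j))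
  (fun j => g (lift ord0 j)) (fun j => mg (lift ord0 j)).
rewrite !ge0_integral_prod_probS//; last 2 first.
- by apply: emeasurable_funM => //; exact/measurable_EFinP.
- by move=> y; rewrite mule_ge0// lee_fin prodr_ge0.
(* The first coordinate changes from [Q] to [P]. Its factor then moves into the inner integral,
   where induction applies to the section of [f] at [x] times that factor. *)
have [_ _ ->] := gd ord0; last 2 first.
- apply: (measurable_fun_fubini_tonelli_F (f \o @cons_space _ _ T)).
  exact: (measurableT_comp mf (@measurable_cons_space _ _ T)).
    by move=> z; exact: f0.
- by move=> t; apply: integral_ge0.
apply: eq_integral => x _.
have mfx : measurable_fun setT
    (fun z : prod_space (fun j : 'I_k => T (lift ord0 j)) => f (cons_space (x, z))).
  have mxz : measurable_fun setT
      (fun z : prod_space (fun j : 'I_k => T (lift ord0 j)) => (x, z)).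
    exact: measurable_pair1.
  have mc := measurableT_comp mf (@measurable_cons_space _ _ T).
  exact: (measurableT_comp mc mxz).
rewrite -ge0_integralZr//.
rewrite (IHk _ (fun j => T (lift ord0 j)) (fun j => P (lift ord0 j))
  (fun j => Q (lift ord0 j)) (fun j => g (lift ord0 j)))//.
- apply: eq_integral => z _; rewrite big_ord_recl cons_space0 -muleA.
  congr (_ * _)%E; rewrite -EFinM; congr (_ * _)%:E.
  by apply: eq_bigr => j _; rewrite cons_spaceS.
- exact: emeasurable_funM.
- by move=> z; rewrite mule_ge0 ?lee_fin.
- by rewrite lee_fin.
Qed.

End product.

(** * Testing error and Hellinger affinity *)

Section mean.
Context d (T : measurableType d) (R : realType) (P : probability T R).
Implicit Types (f g : T -> R) (v w : R).

(** Bundles integrability with a real value, so that comparing expectations reduces to pointwise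
    real inequalities. *)
Definition has_mean f v : Prop :=
  P.-integrable setT (EFin \o f) /\ (\int[P]_t (f t)%:E = v%:E)%E.

Lemma has_mean_measurable f v : has_mean f v -> measurable_fun setT f.
Proof. by move=> [/measurable_int/measurable_EFinP]. Qed.

Lemma integral_probability_cst (r : \bar R) : (\int[P]_t cst r t = r)%E.
Proof.
by rewrite integral_cst// -[RHS]mule1; congr (_ * _)%E; exact: probability_setT.
Qed.

Lemma has_mean_cst v : has_mean (cst v) v.
Proof.
split; first exact: finite_measure_integrable_cst.
exact: (integral_probability_cst v%:E).
Qed.

Lemma has_meanD f g v w :
  has_mean f v -> has_mean g w -> has_mean (fun t => f t + g t) (v + w).
Proof.
move=> [fi fv] [gi gw]; split; first exact: (integrableD measurableT fi gi).
by under eq_integral do rewrite EFinD; rewrite integralD// fv gw.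
Qed.

Lemma has_meanZ (c : R) f v :
  has_mean f v -> has_mean (fun t => c * f t) (c * v).
Proof.
move=> [fi fv]; split; first exact: (integrableZl measurableT c fi).
by under eq_integral do rewrite EFinM; rewrite integralZl// fv.
Qed.

Lemma le_has_mean f g v w : (forall t, f t <= g t) ->
  has_mean f v -> has_mean g w -> v <= w.
Proof.
move=> fg [fi fv] [gi gw]; rewrite -lee_fin -fv -gw.
by apply: le_integral => // t _; rewrite lee_fin.
Qed.

Lemma has_mean_ge0 f v : (forall t, 0 <= f t) -> has_mean f v -> 0 <= v.
Proof. by move=> f0 fv; apply: (le_has_mean f0 _ fv); exact: has_mean_cst. Qed.

Lemma eq_has_mean f g v w : f =1 g -> v = w -> has_mean f v -> has_mean g w.
Proof. by move=> /funext-> ->. Qed.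

Lemma has_mean_le_bound f g w : measurable_fun setT f ->
  (forall t, `|f t| <= g t) -> has_mean g w -> exists v, has_mean f v.
Proof.
move=> mf fg [gi _].
have fi : P.-integrable setT (EFin \o f).
  apply: le_integrable gi => //; first exact/measurable_EFinP.
  by move=> t _; rewrite lee_fin (le_trans (fg t))// ler_norm.
exists (fine (\int[P]_t (f t)%:E)); split=> //.
by rewrite fineK//; exact: integrable_fin_num.
Qed.

Lemma ge0_has_mean f v : measurable_fun setT f -> (forall t, 0 <= f t) ->
  (\int[P]_t (f t)%:E = v%:E)%E -> has_mean f v.
Proof.
move=> mf f0 fv; split=> //; apply/integrableP; split.
  exact/measurable_EFinP.
rewrite (_ : (\int[P]_x _)%E = v%:E) ?ltry// -fv.
by apply: eq_integral => t _; rewrite gee0_abs// lee_fin.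
Qed.

End mean.

Section testing.
Context d (T : measurableType d) (R : realType) (P Q : probability T R).
Variables (L : T -> R) (A : R).
Hypotheses (LPQ : is_density P Q L) (LA : has_mean P (fun t => Num.sqrt (L t)) A).

Let L0 t : 0 <= L t. Proof. by have [] := LPQ. Qed.

Lemma has_mean_density : has_mean P L 1.
Proof.
have [mL _ LE] := LPQ; apply: ge0_has_mean => //.
transitivity (\int[Q]_t cst 1%:E t)%E.
  by rewrite LE//; apply: eq_integral => t _; rewrite mul1e.
by rewrite integral_probability_cst.
Qed.

Let sqrtL t : Num.sqrt (L t) ^+ 2 = L t. Proof. exact: sqr_sqrtr. Qed.

Lemma affinity_ge0 : 0 <= A.
Proof. by apply: has_mean_ge0 LA => t; exact: sqrtr_ge0. Qed.

(** Integrates AM-GM: sqrt L <= (1 + L) / 2. *)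
Lemma affinity_le1 : A <= 1.
Proof.
have -> : 1 = 2^-1 * (1 + 1) :> R by field.
apply: le_has_mean LA
  (has_meanZ 2^-1 (has_meanD (has_mean_cst P 1) has_mean_density)) => t.
rewrite -{2}(sqrtL t) /cst.
have := sqr_ge0 (Num.sqrt (L t) - 1); set s := Num.sqrt _; nra.
Qed.

(** Both expectations move under [P], so that later bounds on the error follow from pointwise
    inequalities in [psi] and [L]. *)
Lemma testing_errorE (psi : T -> R) : measurable_fun setT psi ->
  (forall t, 0 <= psi t <= 1) ->
  exists e, testing_error P Q psi = e%:E /\
    has_mean P (fun t => psi t + L t * (1 - psi t)) e.
Proof.
move=> mpsi psi01; have [mL _ LE] := LPQ.
have [v pv] : exists v, has_mean P psi v.
  apply: has_mean_le_bound (has_mean_cst P 1) => // t.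
  by have /andP[p0 p1] := psi01 t; rewrite ger0_norm.
have mLpsi : measurable_fun setT (fun t => L t * (1 - psi t)).
  by apply: measurable_funM => //; exact: measurable_funB.
have [w pw] : exists w, has_mean P (fun t => L t * (1 - psi t)) w.
  apply: has_mean_le_bound has_mean_density => // t.
  have /andP[p0 p1] := psi01 t.
  by rewrite ger0_norm ?mulr_ge0 ?subr_ge0// ler_piMr// lerBlDr lerDl.
exists (v + w); split; last exact: has_meanD.
rewrite /testing_error unlock EFinD; congr (_ + _)%E; first by case: pv.
rewrite LE.
- by case: pw => _ <-; apply: eq_integral => t _; rewrite -EFinM mulrC.
- by apply/measurable_EFinP; exact: measurable_funB.
- by move=> t; have /andP[p0 p1] := psi01 t; rewrite lee_fin subr_ge0.
Qed.

Lemma testing_error_ge0 (psi : T -> R) (e : R) : measurable_fun setT psi ->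
  (forall t, 0 <= psi t <= 1) -> testing_error P Q psi = e%:E -> 0 <= e.
Proof.
move=> mpsi psi01; have [e' [-> he]] := testing_errorE mpsi psi01.
move=> [<-].
apply: has_mean_ge0 he => t; have /andP[p0 p1] := psi01 t.
by rewrite addr_ge0// mulr_ge0// subr_ge0.
Qed.

(** Cauchy-Schwarz would give A^2 <= e (2 - e), where e is the mean of psi + L (1 - psi) and 2 - e
    that of (1 - psi) + psi L. The proof linearizes it by weighted AM-GM. *)
Lemma sqr_affinity_le (psi : T -> R) (e : R) : measurable_fun setT psi ->
  (forall t, 0 <= psi t <= 1) -> testing_error P Q psi = e%:E ->
  A ^+ 2 <= 2 * e.
Proof.
move=> mpsi psi01 pe; have e0 := testing_error_ge0 mpsi psi01 pe.
move: pe; have [e' [-> he]] := testing_errorE mpsi psi01.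
move=> [ee]; rewrite {e'}ee in he.
have := affinity_ge0; rewrite le_eqVlt => /predU1P[<-|A0].
  by rewrite expr0n/= mulr_ge0.
(* AM-GM with weight a = A / 2, separately on the two sides of the test *)
have : A <= A / 4 * (2 - e) + A^-1 * e.
  have -> : A / 4 * (2 - e) + A^-1 * e =
      A / 4 * ((1 + 1) + -1 * e) + A^-1 * e by field; rewrite gt_eqF.
  apply: le_has_mean LA (has_meanD (has_meanZ (A / 4)
    (has_meanD (has_meanD (has_mean_cst P 1) has_mean_density)
      (has_meanZ (-1) he))) (has_meanZ A^-1 he)) => t.
  have /andP[p0 p1] := psi01 t; rewrite -{2 3 4}(sqrtL t) /cst.
  set s := Num.sqrt _; set p := psi t in p0 p1 *.
  rewrite (_ : _ + _ = p * (A / 4 * s ^+ 2 + A^-1) +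
    (1 - p) * (A / 4 + A^-1 * s ^+ 2)); last by ring.
  have amgm1 : s <= A / 4 * s ^+ 2 + A^-1.
    rewrite -subr_ge0 (_ : _ - _ = A^-1 * (A / 2 * s - 1) ^+ 2).
      by rewrite mulr_ge0 ?sqr_ge0// invr_ge0 ltW.
    by field; rewrite gt_eqF.
  have amgm2 : s <= A / 4 + A^-1 * s ^+ 2.
    rewrite -subr_ge0 (_ : _ - _ = A^-1 * (A / 2 - s) ^+ 2).
      by rewrite mulr_ge0 ?sqr_ge0// invr_ge0 ltW.
    by field; rewrite gt_eqF.
  rewrite [leLHS](_ : s = p * s + (1 - p) * s); last by ring.
  by rewrite lerD// ler_wpM2l// subr_ge0.
rewrite -(ler_pM2l A0) => H.
have : A * (A / 4 * (2 - e) + A^-1 * e) = A ^+ 2 / 4 * (2 - e) + e.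
  by field; rewrite gt_eqF.
have : 0 <= A ^+ 2 * e by rewrite mulr_ge0 ?sqr_ge0.
rewrite expr2 in H *; nra.
Qed.

(** With s = sqrt L, |e - 1| is at most the mean of |L - 1| = |s - 1| (s + 1). Cauchy-Schwarz, again
    through AM-GM with a weight [a], bounds it by the means 2 (1 - A) of (s - 1)^2 and 2 (1 + A) of
    (s + 1)^2. *)
Lemma testing_error_near1 (psi : T -> R) (e : R) : measurable_fun setT psi ->
  (forall t, 0 <= psi t <= 1) -> testing_error P Q psi = e%:E ->
  (1 - e) ^+ 2 <= 8 * (1 - A).
Proof.
move=> mpsi psi01; have [e' [-> he]] := testing_errorE mpsi psi01.
move=> [ee]; rewrite {e'}ee in he; have A1 := affinity_le1.
have bound a : 0 < a -> `|e - 1| <= a^-1 * (1 - A) + 2 * a.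
  move=> a0.
  (* This is (s - 1)^2 / (2 a) + a (s + 1)^2 / 2, expanded in L and s = sqrt L so that its mean is
     explicit. *)
  pose r := fun t => (2 * a)^-1 * (L t + cst 1 t) +
    (a / 2 * (L t + cst 1 t) + (a - a^-1) * Num.sqrt (L t)).
  have hr : has_mean P r (a^-1 * (1 - A) + a * (1 + A)).
    have hL1 := has_meanD has_mean_density (has_mean_cst P 1).
    have := has_meanD (has_meanZ (2 * a)^-1 hL1)
      (has_meanD (has_meanZ (a / 2) hL1) (has_meanZ (a - a^-1) LA)).
    by apply: eq_has_mean => //; field; rewrite gt_eqF.
  have rE t : `|L t - 1| <= r t.
    rewrite /r /cst -(sqrtL t) sqrtr_sqr (ger0_norm (sqrtr_ge0 (L t))).
    set s := Num.sqrt _; have s0 : 0 <= s by exact: sqrtr_ge0.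
    have -> : s ^+ 2 - 1 = (s - 1) * (s + 1) by ring.
    rewrite normrM (ger0_norm (_ : 0 <= s + 1)) ?addr_ge0//.
    have -> : (2 * a)^-1 * (s ^+ 2 + 1) + (a / 2 * (s ^+ 2 + 1) + (a - a^-1) * s)
        = (2 * a)^-1 * `|s - 1| ^+ 2 + a / 2 * (s + 1) ^+ 2.
      by rewrite real_normK ?num_real//; field; rewrite gt_eqF.
    rewrite -subr_ge0 (_ : _ - _ = (2 * a)^-1 * (`|s - 1| - a * (s + 1)) ^+ 2).
      by rewrite mulr_ge0 ?sqr_ge0// invr_ge0 mulr_ge0// ltW.
    by field; rewrite gt_eqF.
  have hL t : `|psi t + L t * (1 - psi t) - L t| <= r t.
    apply: le_trans (rE t); have /andP[p0 p1] := psi01 t.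
    have -> : psi t + L t * (1 - psi t) - L t = - (psi t * (L t - 1)) by ring.
    by rewrite normrN normrM ger0_norm// ler_piMl.
  have : `|e - 1| <= a^-1 * (1 - A) + a * (1 + A).
    rewrite ler_norml; apply/andP; split.
      rewrite lerBrDr.
      rewrite -mulN1r.
      apply: le_has_mean (has_meanD (has_meanZ (-1) hr) has_mean_density) he => t.
      by have := hL t; rewrite ler_norml => /andP[]; lra.
    rewrite lerBlDr; apply: le_has_mean he (has_meanD hr has_mean_density) => t.
    by have := hL t; rewrite ler_norml => /andP[]; lra.
  by move=> /le_trans; apply; rewrite lerD2l; nra.
rewrite -sqrrN opprB -[leLHS]real_normK ?num_real//.
have [->|t0] := eqVneq `|e - 1| 0.
  by rewrite expr0n/= mulr_ge0// subr_ge0.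
have {}t0 : 0 < `|e - 1| by rewrite lt0r t0 normr_ge0.
(* The weight a = |e - 1| / 4 makes the term 2 a half of the left-hand side, which absorbs it. *)
have := bound _ (divr_gt0 t0 (ltr0n _ 4)).
set t := `|e - 1| in t0 *; rewrite -(ler_pM2l t0).
have -> : t * ((t / 4%:R)^-1 * (1 - A) + 2 * (t / 4%:R)) =
    4 * (1 - A) + t ^+ 2 / 2 by field; rewrite gt_eqF.
by rewrite expr2; nra.
Qed.

Lemma measurable_density_gt (c : R) :
  measurable_fun setT (\1_[set t | c < L t] : T -> R).
Proof.
apply: measurable_indic; rewrite -[X in measurable X]setTI.
have [mL _ _] := LPQ; have := mL measurableT `]c, +oo[%classic.
rewrite (_ : _ @^-1` _ = [set t | c < L t]).
  by apply; exact: measurable_itv.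
by apply/seteqP; split=> t /=; rewrite in_itv/= andbT.
Qed.

Lemma indic01 (B : set T) t : 0 <= (\1_B t : R) <= 1.
Proof. by rewrite indicE; case: (_ \in _); rewrite ?lexx ler01. Qed.

(** The error of this test is the mean of min(1, L), which never exceeds sqrt L. *)
Lemma likelihood_ratio_error (e : R) :
  testing_error P Q \1_[set t | 1 < L t] = e%:E -> e <= A.
Proof.
have [e' [-> he]] :=
  testing_errorE (measurable_density_gt 1) (indic01 [set t | 1 < L t]).
move=> [<-].
apply: le_has_mean he LA => t; rewrite indicE.
have s0 : 0 <= Num.sqrt (L t) by exact: sqrtr_ge0.
have := sqrtL t; set s := Num.sqrt _ in s0 *; rewrite expr2 => sL.
case: (ltP 1 (L t)) => L1.
  by rewrite mem_set//= subrr mulr0 addr0; nra.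
by rewrite memNset ?subr0 ?mulr1 ?add0r/=; [nra|apply/negP; rewrite -leNgt].
Qed.

End testing.

(** * Nonnegative real densities *)

Section real_density.
Context d (T : measurableType d) (R : realType).
Implicit Types P mu nu : probability T R.

(* The library's Radon-Nikodym derivative made real and nonnegative everywhere. *)
Definition real_density nu P (t : T) : R := Num.max 0 (fine (density nu P t)).

Lemma density_fin_num nu P t : nu `<< P -> density nu P t \is a fin_num.
Proof. by rewrite /density => nuP; exact: Radon_Nikodym_fin_num. Qed.

Lemma integrable_density nu P : nu `<< P -> P.-integrable setT (density nu P).
Proof. by rewrite /density => nuP; exact: Radon_Nikodym_integrable. Qed.

Lemma measurable_density nu P : nu `<< P -> measurable_fun setT (density nu P).
Proof. by move=> /integrable_density/measurable_int. Qed.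

Lemma density_integral nu P A : nu `<< P -> measurable A ->
  (nu A = \int[P]_(t in A) density nu P t)%E.
Proof.
rewrite /density => nuP mA.
by rewrite -(Radon_Nikodym_integral (nu := charge_of_finite_measure nu)).
Qed.

Lemma measurable_fine_density nu P : nu `<< P ->
  measurable_fun setT (fun t => fine (density nu P t)).
Proof.
move=> nuP; apply/measurable_EFinP.
apply: (eq_measurable_fun (density nu P)).
  by move=> t _ /=; rewrite fineK// density_fin_num.
exact: measurable_density.
Qed.

Lemma measurable_real_density nu P : nu `<< P ->
  measurable_fun setT (real_density nu P).
Proof.
move=> nuP; apply: measurable_maxr; first exact: measurable_cst.
exact: measurable_fine_density.
Qed.

Lemma real_density_ge0 nu P t : 0 <= real_density nu P t.
Proof. by rewrite le_max lexx. Qed.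

(** The derivative agrees almost everywhere with [Radon_Nikodym_SigmaFinite.f], which is nonnegative
    everywhere, so the truncation at 0 acts on a null set only. *)
Lemma ae_eq_real_density nu P : nu `<< P ->
  ae_eq P setT (density nu P) (EFin \o real_density nu P).
Proof.
move=> nuP; apply: filterS (ae_eq_Radon_Nikodym_SigmaFinite nuP measurableT).
move=> t /(_ I) fE _; have f0 := Radon_Nikodym_SigmaFinite.f_ge0 nuP t.
have d0 : (0 <= density nu P t)%E by rewrite /density -fE.
by rewrite /= /real_density max_r ?fine_ge0// fineK// density_fin_num.
Qed.

Lemma is_density_real_density nu P : nu `<< P ->
  is_density P nu (real_density nu P).
Proof.
move=> nuP; split; first exact: measurable_real_density.
  by move=> t; exact: real_density_ge0.
move=> f mf f0.
rewrite -(Radon_Nikodym_SigmaFinite.change_of_variables nuP f0 measurableT mf).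
apply: ae_eq_integral => //.
- apply: emeasurable_funM => //.
  exact: measurable_int (Radon_Nikodym_SigmaFinite.f_integrable nuP).
- apply: emeasurable_funM => //; apply/measurable_EFinP.
  exact: measurable_real_density.
- apply: ae_eqe_mul2l; apply: ae_eq_trans (ae_eq_real_density nuP).
  exact: ae_eq_Radon_Nikodym_SigmaFinite.
Qed.

Lemma real_density_integral nu P A : nu `<< P -> measurable A ->
  (nu A = \int[P]_(t in A) (real_density nu P t)%:E)%E.
Proof.
move=> nuP mA; rewrite (density_integral nuP mA).
apply: ae_eq_integral => //.
- apply: measurable_funTS; exact: measurable_density.
- apply: measurable_funTS; apply/measurable_EFinP; exact: measurable_real_density.
- apply: filterS (ae_eq_real_density nuP) => t H _; exact: H.
Qed.

(** Uniqueness of densities: both sides integrate to the mixture's measure on every measurable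
    set. *)
Lemma ae_eq_density_mixture mu P (e : {i01 R}) : mu `<< P ->
  ae_eq P setT (real_density (mixture e P mu) P)
    (fun t => 1 - e%:num + e%:num * real_density mu P t).
Proof.
move=> muP; set F := real_density mu P.
have e0 : 0 <= e%:num by [].
have e1 : 0 <= 1 - e%:num by rewrite subr_ge0.
have mF : measurable_fun setT F by exact: measurable_real_density.
have G0 t : 0 <= 1 - e%:num + e%:num * F t.
  by rewrite addr_ge0// mulr_ge0// real_density_ge0.
have : ae_eq P setT (density (mixture e P mu) P)
    (EFin \o (fun t => 1 - e%:num + e%:num * F t)).
  apply: integral_ae_eq => //.
  - exact: integrable_density (mixture_dominates e muP).
  - apply/measurable_EFinP; apply: measurable_funD => //.
    exact: measurable_funM.
  move=> A _ mA; rewrite -(density_integral (mixture_dominates e muP) mA).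
  transitivity ((1 - e%:num)%:E * P A + e%:num%:E * mu A)%E.
    by rewrite /= /mixture measure_addE.
  under eq_integral do rewrite /= EFinD EFinM.
  rewrite ge0_integralD//.
  - rewrite (integral_cst P mA) (real_density_integral muP mA).
    rewrite ge0_integralZl//; last by move=> t _; rewrite lee_fin real_density_ge0.
    by apply: measurable_funTS; exact/measurable_EFinP.
  - by move=> t _; rewrite -EFinM lee_fin mulr_ge0// real_density_ge0.
  - apply: measurable_funTS; apply/measurable_EFinP; exact: measurable_funM.
move=> /(ae_eq_comp (fun x => Num.max 0 (fine x))); apply: filterS => t /(_ I) /= H _.
by rewrite /real_density H max_r.
Qed.

Lemma ae_has_mean P (f g : T -> R) v : ae_eq P setT f g ->
  measurable_fun setT g -> has_mean P f v -> has_mean P g v.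
Proof.
move=> /(ae_eq_comp EFin) fg /measurable_EFinP mg [fi fv]; split.
  apply/integrableP; split=> //; have /integrableP[mf] := fi.
  apply: le_lt_trans; rewrite le_eqVlt; apply/orP; left; apply/eqP.
  apply: ae_eq_integral => //; [exact: measurableT_comp|exact: measurableT_comp|].
  exact/ae_eq_sym/(ae_eq_comp abse fg).
rewrite -fv; apply/esym/ae_eq_integral => //; exact: measurable_int fi.
Qed.

Lemma measurable_sqrt (f : T -> R) : measurable_fun setT f ->
  measurable_fun setT (fun t => Num.sqrt (f t)).
Proof.
move=> mf; apply: measurableT_comp mf.
by apply: continuous_measurable_fun; exact: sqrt_continuous.
Qed.

End real_density.

(** * Comparison of the affinity with the signals *)

Section marginal.
Context (R : realType).
Implicit Types (tau e u s w : R).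

(* [w] is the value at [u = e * dmu/dP] of the integrand of the two signals,
   completed by a multiple of [dmu/dP - 1], which has mean zero. *)
Lemma hellinger_comparison tau e u s w : 0 < tau -> 0 <= e -> e <= 4^-1 ->
  e <= tau / 2 -> 0 <= u -> 0 <= s -> s ^+ 2 = 1 - e + u ->
  w = (if tau < u then u * (1 - 2 * e) + e ^+ 2 else (u - e) ^+ 2) ->
  (1 - s) ^+ 2 <= (2 + 4 / tau) * w /\
  tau / (16 * (2 + tau) ^+ 2) * w <= (1 - s) ^+ 2.
Proof.
move=> tau0 e0 e4 etau u0 s0 sE ->.
have tau2 : 0 < 2 + tau by lra.
have D0 : 0 <= (1 - s) ^+ 2 by exact: sqr_ge0.
(* Since 1 - s^2 = e - u, the size of (1 - s)^2 is governed by that of (s + 1)^2. *)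
have sD : (1 - s) ^+ 2 * (s + 1) ^+ 2 = (u - e) ^+ 2.
  by rewrite -exprMn (_ : _ * _ = 1 - s ^+ 2); [rewrite sE; ring|ring].
have s1 : (s + 1) ^+ 2 <= 2 * (2 - e + u).
  have := sqr_ge0 (s - 1).
  by rewrite (_ : 2 - e + u = s ^+ 2 + 1); [rewrite !expr2; nra|rewrite sE; ring].
have s1' : 1 <= (s + 1) ^+ 2 by rewrite expr2; nra.
case: ltP => ut; split.
(* Case tau < u, upper bound: (1 - s)^2 <= 2 + u <= (1 + 2 / tau) u because u / tau >= 1, while w >=
   u / 2 because e <= 1/4. *)
- have itau : 0 < tau^-1 by rewrite invr_gt0.
  have u1 : 1 <= u / tau by rewrite ler_pdivlMr// mul1r ltW.
  have : (1 - s) ^+ 2 <= 2 + u.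
    rewrite (_ : (1 - s) ^+ 2 = s ^+ 2 + 1 - 2 * s); last by ring.
    by rewrite sE; lra.
  move=> /le_trans; apply.
  apply: (@le_trans _ _ ((2 + 4 / tau) * (u / 2))).
    by rewrite (_ : _ * (u / 2) = u + 2 * (u / tau)); [lra|field; rewrite gt_eqF].
  rewrite ler_pM2l; last by rewrite addr_gt0// mulr_gt0.
  by rewrite expr2; nra.
- have w2u : u * (1 - 2 * e) + e ^+ 2 <= 2 * u by rewrite expr2; nra.
  have w0 : 0 <= u * (1 - 2 * e) + e ^+ 2 by rewrite expr2; nra.
  apply: (@le_trans _ _ (tau / (16 * (2 + tau)) * (2 * u))).
    apply: ler_pM => //.
      by rewrite divr_ge0 ?mulr_ge0 ?sqr_ge0 ?ltW.
    rewrite ler_pM2l// lef_pV2 ?posrE ?mulr_gt0 ?exprn_gt0//.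
    by rewrite expr2; nra.
  rewrite -(@ler_pM2r _ (8 * (2 + tau))) ?mulr_gt0//.
  rewrite [leLHS](_ : _ = tau * u); last by field; rewrite gt_eqF.
  (* From e <= tau / 2 < u / 2 follows (u - e)^2 >= u^2 / 4. Dividing by the bound on (s + 1)^2
     leaves a multiple of u^2 / (2 + u), and u / (2 + u) increases with u, so it is at least its
     value at tau. *)
  have H1 : u ^+ 2 / 4 <= (1 - s) ^+ 2 * (2 * (2 + u)).
    apply: (@le_trans _ _ ((u - e) ^+ 2)); first by rewrite !expr2; nra.
    rewrite -sD ler_wpM2l//; apply: le_trans s1 _; lra.
  have H2 : u * (u / (2 + u)) <= (1 - s) ^+ 2 * 8.
    have u2 : 0 < 2 + u by lra.
    by rewrite mulrA ler_pdivrMr// -expr2; lra.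
  have u2 : 0 < 2 + u by lra.
  have H3 : tau <= (2 + tau) * (u / (2 + u)).
    by rewrite mulrA ler_pdivlMr//; nra.
  have : tau * u <= (2 + tau) * (u / (2 + u)) * u by rewrite ler_wpM2r.
  nra.
(* Case u <= tau: w is exactly (u - e)^2, and (s + 1)^2 lies between 1 and 2 (2 + tau). *)
- apply: (@le_trans _ _ ((u - e) ^+ 2)).
    by rewrite -sD ler_peMr.
  by rewrite ler_peMl ?sqr_ge0// (@le_trans _ _ 2) ?ler1n// lerDl divr_ge0// ltW.
- rewrite -sD mulrCA ler_piMr// mulrAC ler_pdivrMr ?mulr_gt0 ?exprn_gt0// mul1r.
  have : (s + 1) ^+ 2 <= 2 * (2 + tau) by apply: le_trans s1 _; lra.
  by rewrite -(ler_pM2l tau0) => /le_trans; apply; rewrite (expr2 (2 + tau)); nra.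
Qed.

(** On this range (1 + 2 h) (1 - h) >= 1, and exp(2 h) >= 1 + 2 h. *)
Lemma expRN2_le (h : R) : 0 <= h <= 2^-1 -> expR (- (2 * h)) <= 1 - h.
Proof.
move=> /andP[h0 h2]; rewrite expRN invf_ple ?posrE ?expR_gt0 ?subr_gt0//; last by lra.
apply: le_trans (expR_ge1Dx _); rewrite -div1r ler_pdivrMr; [nra|lra].
Qed.


(** The 16 of [hellinger_comparison] doubles because the mean of (1 - s)^2 is 2 (1 - a). In
    [upper_rate] the same factor 2 is spent on a >= exp(- 2 (1 - a)). *)
Definition lower_rate tau : R := tau / (32 * (2 + tau) ^+ 2).
Definition upper_rate tau : R := 2 + 4 / tau.

(** The bounds integrate [hellinger_comparison]. Smallness of [e] is demanded only in the last
    clause, so that [a], [i1] and [i2] exist at every index. *)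
Lemma affinity_marginal d (T : measurableType d) (P mu : probability T R)
    (e : {i01 R}) tau : mu `<< P -> 0 < tau ->
  exists a i1 i2,
    [/\ has_mean P (fun t => Num.sqrt (real_density (mixture e P mu) P t)) a,
        (e%:num%:E * mu [set t | tau%:E < e%:num%:E * density mu P t] = i1%:E)%E,
        ((e%:num ^+ 2)%:E * \int[P]_t (density mu P t ^+ 2 *
          (\1_[set t | (e%:num%:E * density mu P t <= tau%:E)%E] t)%:E - 1)
          = i2%:E)%E,
        0 <= i1 &
        e%:num <= 4^-1 -> e%:num <= tau / 2 ->
          [/\ - (i1 / 2) <= i2,
            expR (- (upper_rate tau * (i1 + i2))) <= a &
            a <= expR (- (lower_rate tau * (i1 + i2)))]].
Proof.
move=> muP tau0; set F := real_density mu P.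
have E0 : 0 <= e%:num by [].
have E1 : e%:num <= 1 by [].
set E := e%:num in E0 E1 *.
have F0 t : 0 <= F t by exact: real_density_ge0.
have mF : measurable_fun setT F by exact: measurable_real_density.
have [_ _ FE] := is_density_real_density muP.
have hF : has_mean P F 1.
  exact: has_mean_density (is_density_real_density muP).
pose u t := E * F t.
have mu_ : measurable_fun setT u by exact: measurable_funM.
have u0 t : 0 <= u t by rewrite mulr_ge0.
have hu : has_mean P u E by have := has_meanZ E hF; rewrite mulr1.
pose B := [set t | tau < u t].
have mB : measurable B.
  have := mu_ measurableT _ (measurable_itv `]tau, +oo[).
  rewrite setTI (_ : _ @^-1` _ = B)//.
  by apply/seteqP; split=> t /=; rewrite in_itv/= andbT.
have BE t : (\1_B t : R) = (tau < u t)%R%:R.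
  by rewrite indicE (_ : (t \in B) = (tau < u t)%R)//; apply/idP/idP; rewrite inE.
have dE t : density mu P t = (fine (density mu P t))%:E.
  by rewrite fineK// density_fin_num.
(* Where the derivative is negative, [F] is 0; as tau > 0, neither passes the threshold. The two
   events thus agree everywhere, not only almost everywhere. *)
have tauE t : (tau < E * fine (density mu P t)) = (tau < u t).
  rewrite /u /F /real_density; case: (leP 0 (fine (density mu P t))) => d0.
    by [].
  rewrite mulr0; apply/idP/idP; last by lra.
  by move=> h; have := mulr_ge0_le0 E0 (ltW d0); lra.
have B1 : [set t | (tau%:E < E%:E * density mu P t)%E] = B.
  by apply/seteqP; split=> t /=; rewrite dE -EFinM lte_fin tauE.
have [i1 h1] : exists i1, has_mean P (fun t => u t * \1_B t) i1.
  apply: has_mean_le_bound hu.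
    by apply: measurable_funM => //; exact: measurable_indic.
  by move=> t; rewrite BE; case: ltP => _; rewrite ?mulr1 ?mulr0 ?normr0// ger0_norm.
have i1_ge0 : 0 <= i1.
  by apply: has_mean_ge0 h1 => t; rewrite mulr_ge0.
have i1E : (E%:E * mu B = i1%:E)%E.
  have -> : mu B = (\int[mu]_t (\1_B t)%:E)%E by rewrite integral_indic// setIT.
  rewrite FE; last 2 first.
  - by apply/measurable_EFinP; exact: measurable_indic.
  - by move=> t; rewrite lee_fin.
  rewrite -ge0_integralZl//.
  - have [_ <-] := h1; apply: eq_integral => t _.
    by rewrite -!EFinM -/(F t) /u; congr _%:E; ring.
  - apply/measurable_EFinP; apply: measurable_funM => //; exact: measurable_indic.
  - by move=> t _; rewrite -EFinM lee_fin mulr_ge0.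
have mq (f : T -> R) : measurable_fun setT f ->
    measurable_fun setT (fun t => f t ^+ 2 * (u t <= tau)%R%:R - 1).
  move=> mf; apply: measurable_funB => //; apply: measurable_funM.
    exact: measurable_funX.
  rewrite (_ : (fun t => _) = fun t => 1 - \1_B t).
    by apply: measurable_funB => //; exact: measurable_indic.
  by apply/funext => t; rewrite BE; case: ltP; rewrite ?subrr ?subr0.
pose V t := F t ^+ 2 * (u t <= tau)%R%:R - 1.
have mV : measurable_fun setT V by exact: mq.
have VE : (\int[P]_t (density mu P t ^+ 2 *
    (\1_[set t | (E%:E * density mu P t <= tau%:E)%E] t)%:E - 1) =
    \int[P]_t (V t)%:E)%E.
  under eq_integral => t _.
    rewrite (_ : \1__ t = (u t <= tau)%R%:R); last first.
      rewrite indicE leNgt -tauE -leNgt; congr (nat_of_bool _)%:R.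
      by apply/idP/idP; rewrite inE/= dE -EFinM lee_fin.
    rewrite dE -EFin_expe -EFinM -EFinB.
    over.
  apply: ae_eq_integral => //.
  - by apply/measurable_EFinP; apply: mq; exact: measurable_fine_density.
  - exact/measurable_EFinP.
  - apply: filterS (ae_eq_real_density muP) => t /(_ I) H _.
    by rewrite /V /F /= H.
(* The factor E^2 stays inside: E^2 V is bounded by tau^2 + 1, whereas V may fail to be integrable
   when E = 0. *)
have [i2 h2] : exists i2, has_mean P (fun t => E ^+ 2 * V t) i2.
  apply: (has_mean_le_bound _ _ (has_mean_cst P (tau ^+ 2 + 1))).
    exact: measurable_funM.
  move=> t; rewrite /cst /V mulrBr mulrA -exprMn mulr1.
  apply: le_trans (ler_normB _ _) _; rewrite ![`|_|]ger0_norm ?mulr_ge0 ?sqr_ge0//.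
  apply: lerD; last by rewrite expr_le1.
  case: (leP (u t) tau) => ut; rewrite ?mulr1 ?mulr0 ?sqr_ge0//=.
  by rewrite ler_sqr ?nnegrE; [exact: ut|exact: u0|exact: ltW].
have i2E : ((E ^+ 2)%:E * \int[P]_t (V t)%:E = i2%:E)%E.
  (* At E = 0 the integral of V may be infinite, and the convention that 0 times infinity is 0
     settles the case. *)
  have [E00|En0] := eqVneq E 0.
    have [_ <-] := h2; rewrite E00 expr0n mul0e.
    by under eq_integral do rewrite mul0r; rewrite integral0.
  have hV : has_mean P V (E ^- 2 * i2).
    apply: eq_has_mean (has_meanZ (E ^- 2) h2) => // t.
    by rewrite mulrA mulVf ?mul1r// expf_neq0.
  by case: hV => _ ->; rewrite -EFinM mulrA divff ?mul1r// expf_neq0.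
set g := real_density (mixture e P mu) P.
pose s t := Num.sqrt (1 - E + u t).
have G0 t : 0 <= 1 - E + u t by rewrite addr_ge0// subr_ge0.
have sE t : s t ^+ 2 = 1 - E + u t by rewrite sqr_sqrtr.
have s0 t : 0 <= s t by exact: sqrtr_ge0.
have hG : has_mean P (fun t => 1 - E + u t) 1.
  by apply: eq_has_mean (has_meanD (has_mean_cst P (1 - E)) hu) => //; ring.
have ms : measurable_fun setT s by exact/measurable_sqrt/(has_mean_measurable hG).
have [a ha] : exists a, has_mean P s a.
  apply: has_mean_le_bound (has_meanD hG (has_mean_cst P 1)) => // t.
  by rewrite ger0_norm// -sE /cst; have := s0 t; rewrite expr2; nra.
have gE : ae_eq P setT g (fun t => 1 - E + u t) by exact: ae_eq_density_mixture.
exists a, i1, i2; split.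
- apply: ae_has_mean ha.
    by apply: ae_eq_sym; apply: (ae_eq_comp Num.sqrt gE).
  by apply: measurable_sqrt; exact/measurable_real_density/mixture_dominates.
- by rewrite B1.
- by rewrite VE.
- exact: i1_ge0.
move=> E4 Etau.
(* The last bracket, - 2 E^2 (F - 1), has mean zero and completes the square off [B]. *)
pose W t := u t * \1_B t + (E ^+ 2 * V t + (-2 * E ^+ 2 * F t + cst (2 * E ^+ 2) t)).
have hW : has_mean P W (i1 + i2).
  apply: eq_has_mean (has_meanD h1 (has_meanD h2 (has_meanD
    (has_meanZ (-2 * E ^+ 2) hF) (has_mean_cst P (2 * E ^+ 2))))) => //.
  by rewrite mulr1 mulNr addNr addr0.
have WE t : W t = if tau < u t then u t * (1 - 2 * E) + E ^+ 2 else (u t - E) ^+ 2.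
  by rewrite /W /V /cst BE /u; case: ltP => _ /=; ring.
have hD : has_mean P (fun t => (1 - s t) ^+ 2) (2 * (1 - a)).
  have := has_meanD (has_meanD (has_mean_cst P 1) hG) (has_meanZ (-2) ha).
  by apply: eq_has_mean => [t|]; rewrite -?sE /cst; ring.
have cmp t := hellinger_comparison tau0 E0 E4 Etau (u0 t) (s0 t) (sE t) (WE t).
have up : 2 * (1 - a) <= (2 + 4 / tau) * (i1 + i2).
  by apply: le_has_mean hD (has_meanZ _ hW) => t; have [] := cmp t.
have lo : tau / (16 * (2 + tau) ^+ 2) * (i1 + i2) <= 2 * (1 - a).
  by apply: le_has_mean (has_meanZ _ hW) hD => t; have [] := cmp t.
have a1 : a <= 1.
  by have := has_mean_ge0 (fun t => sqr_ge0 (1 - s t)) hD; lra.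
(* Here s^2 >= 1 - E >= 3/4, so s >= 1/2; this puts 1 - a in the range of [expRN2_le]. *)
have a2 : 2^-1 <= a.
  apply: le_has_mean (has_mean_cst P 2^-1) ha => t.
  by rewrite /cst; have := u0 t; have := sE t; have := s0 t; rewrite expr2; nra.
split.
(* On [B], W >= u / 2 because E <= 1/4; off [B], W is a square. *)
- suff : 0 <= (i1 + i2) + - 2^-1 * i1 by lra.
  apply: has_mean_ge0 (has_meanD hW (has_meanZ (- 2^-1) h1)) => t.
  rewrite WE BE; case: ltP => _; rewrite ?mulr1 ?mulr0 ?addr0 ?sqr_ge0//.
  by have := u0 t; rewrite expr2; nra.
- apply: (@le_trans _ _ (expR (- (2 * (1 - a))))).
    by rewrite ler_expR lerN2.
  have := @expRN2_le (1 - a).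
  by rewrite [1 - (1 - a)]subKr; apply; apply/andP; split; lra.
- apply: (@le_trans _ _ (expR (- (1 - a)))).
    by have := expR_ge1Dx (- (1 - a)); lra.
  rewrite ler_expR lerN2 -(ler_pM2l (ltr0n R 2)) (le_trans _ lo)//.
  rewrite /lower_rate le_eqVlt; apply/orP; left; apply/eqP; field.
  by rewrite gt_eqF// addr_gt0.
Qed.

End marginal.

(** * Asymptotics *)

Section product_affinity.
Context (R : realType).

Lemma sqrtr_prod (I : Type) (r : seq I) (F : I -> R) : (forall i, 0 <= F i) ->
  Num.sqrt (\prod_(i <- r) F i) = \prod_(i <- r) Num.sqrt (F i).
Proof.
move=> F0; elim: r => [|i r IHr]; first by rewrite !big_nil sqrtr1.
by rewrite !big_cons sqrtrM// IHr.
Qed.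

(** If every term is positive, exponentiate. If some term is nonpositive, the sum is -oo and the
    product has a zero factor, so both sides are false. *)
Lemma lt_sum_lne (k : nat) (x : 'I_k -> \bar R) (c : R) :
  (forall i, x i \is a fin_num) ->
  (c%:E < \sum_(i < k) lne (x i))%E =
  (expR c < \prod_(i < k) Num.max 0 (fine (x i))).
Proof.
move=> xfin.
have [/forallP xpos|/forallPn[i]] := boolP [forall i, 0 < fine (x i)].
  have -> : (\sum_(i < k) lne (x i) = (\sum_(i < k) ln (fine (x i)))%:E)%E.
    rewrite -sumEFin; apply: eq_bigr => i _.
    by rewrite -{1}(fineK (xfin i)) lne_EFin.
  rewrite lte_fin -[LHS]ltr_expR expR_sum; congr (_ < _).
  by apply: eq_bigr => i _; rewrite lnK ?posrE// max_r// ltW.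
rewrite -leNgt => xi0; rewrite (bigD1 i)//= [X in _ = (_ < X)](bigD1 i)//=.
rewrite le0_lneNy; last by rewrite -(fineK (xfin i)) lee_fin.
by rewrite addNye max_l// mul0r [RHS]ltNge expR_ge0.
Qed.

(** Affinities multiply over the coordinates, so the exponents of the marginal bounds add up while
    the rates stay the same. *)
Lemma affinity_product (k : nat -> nat)
    (d : forall n, 'I_(k n) -> measure_display)
    (T : forall n (i : 'I_(k n)), measurableType (d n i))
    (P mu : forall n (i : 'I_(k n)), probability (T n i) R)
    (eps : forall n, 'I_(k n) -> {i01 R}) (tau : R) (n : nat) :
  (forall i, mu n i `<< P n i) -> 0 < tau ->
  exists A s1 s2,
    [/\ has_mean (null P n) (fun y => Num.sqrt (\prod_(i < k n)
          real_density (signal_marginal P mu eps i) (P n i) (y i))) A,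
        signal1 P mu eps n tau = s1%:E, signal2 P mu eps n tau = s2%:E,
        0 <= s1 &
        (forall i, (eps n i)%:num <= Num.min 4^-1 (tau / 2)) ->
          [/\ - (s1 / 2) <= s2,
            expR (- (upper_rate tau * (s1 + s2))) <= A &
            A <= expR (- (lower_rate tau * (s1 + s2)))]].
Proof.
move=> muP tau0.
have /choice[a] := fun i => affinity_marginal (eps n i) (muP i) tau0.
move=> /choice[i1] /choice[i2] H.
exists (\prod_i a i), (\sum_i i1 i), (\sum_i i2 i); split.
- have mg i : measurable_fun setT
      (real_density (signal_marginal P mu eps i) (P n i)).
    exact/measurable_real_density/mixture_dominates.
  have ms i : measurable_fun setT
      (fun t => Num.sqrt (real_density (signal_marginal P mu eps i) (P n i) t)).
    exact: measurable_sqrt.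
  rewrite (_ : (fun y => _) = fun y => \prod_(i < k n) Num.sqrt
    (real_density (signal_marginal P mu eps i) (P n i) (y i))); last first.
    by apply/funext => y; rewrite sqrtr_prod// => i; exact: real_density_ge0.
  apply: ge0_has_mean.
  + exact: (measurable_prod_coord ms).
  + by move=> y; apply: prodr_ge0 => i _; exact: sqrtr_ge0.
  + apply: (ge0_integral_prod_coord ms) => i; first by move=> t; exact: sqrtr_ge0.
    by have [[]] := H i.
- by rewrite /signal1 -sumEFin; apply: eq_bigr => i _; case: (H i).
- by rewrite /signal2 -sumEFin; apply: eq_bigr => i _; case: (H i).
- by apply: sumr_ge0 => i _; case: (H i).
move=> eps_le.
have {}H i : [/\ - (i1 i / 2) <= i2 i,
    expR (- (upper_rate tau * (i1 i + i2 i))) <= a i &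
    a i <= expR (- (lower_rate tau * (i1 i + i2 i)))].
  have := eps_le i; rewrite le_min => /andP[e4 e2].
  by case: (H i) => _ _ _ _; apply.
rewrite -big_split/= !mulr_sumr -!sumrN !expR_sum; split.
- by rewrite mulr_suml -sumrN; apply: ler_sum => i _; case: (H i).
- by apply: ler_prod => i _; rewrite expR_ge0/=; case: (H i).
- apply: ler_prod => i _; have [_ l u] := H i.
  by rewrite u andbT (le_trans _ l)// expR_ge0.
Qed.

End product_affinity.

(** * Limits of the affinity in terms of the signals *)

Section limits.
Context (R : realType).
Implicit Types u : nat -> R.

Lemma sqr_cvg0 u : (u n) ^+ 2 @[n --> \oo] --> 0 -> u n @[n --> \oo] --> 0.
Proof.
move=> u2; apply/norm_cvg0P.
rewrite (_ : (fun n => _) = fun n => Num.sqrt (u n ^+ 2)); last first.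
  by apply/funext => n; rewrite sqrtr_sqr.
by rewrite -[X in _ --> X]sqrtr0; apply: continuous_cvg => //; exact: sqrt_continuous.
Qed.

Variables (A s1 s2 : nat -> R) (lo up : R).
Hypotheses (lo0 : 0 < lo) (up0 : 0 < up) (s10 : forall n, 0 <= s1 n)
  (bounds : \forall n \near \oo, [/\ - (s1 n / 2) <= s2 n,
    expR (- (up * (s1 n + s2 n))) <= A n &
    A n <= expR (- (lo * (s1 n + s2 n)))]).

(** From s1 >= 0 and s2 >= - s1 / 2, the sum s1 + s2 lies between half and twice the maximum of s1
    and s2. *)
Lemma affinity_cvg0 :
  A n @[n --> \oo] --> 0 <->
  (maxe (s1 n)%:E (s2 n)%:E @[n --> \oo] --> +oo)%E.
Proof.
split.
- move=> A0; apply/cvgeyPge => M.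
  have d0 : 0 < expR (- (up * (2 * `|M|))) by exact: expR_gt0.
  have nA : \forall n \near \oo, A n < expR (- (up * (2 * `|M|))).
    exact: cvgr_lt A0 _ d0.
  apply: filterS (filterI bounds nA) => n [[b1 b2 _] An].
  have := le_lt_trans b2 An.
  rewrite ltr_expR ltrN2 ltr_pM2l// => SM.
  rewrite -EFin_max lee_fin le_max; apply/orP.
  have := ler_norm M; case: (leP (s1 n) (s2 n)) => ss ?; [right|left]; lra.
- move=> /cvgeyPge smax; apply/cvgr0Pnorm_lt => d d0.
  (* Half of this threshold bounds s1 + s2 from below and exceeds - ln d / lo; the added 1 makes the
     inequality strict. *)
  have nS := smax (2 * `|ln d / lo| + 1).
  apply: filterS (filterI bounds nS) => n [[b1 b2 b3] ss].
  rewrite -EFin_max lee_fin le_max in ss.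
  have A0 : 0 <= A n by apply: le_trans b2; exact: expR_ge0.
  rewrite ger0_norm//; apply: le_lt_trans b3 _.
  rewrite -[ltRHS](@lnK _ d) ?posrE// ltr_expR ltrNl -ltr_pdivrMl//.
  rewrite mulrN mulrC; have := ler_norm (- (ln d / lo)); rewrite normrN.
  by have := s10 n; case/orP: ss; lra.
Qed.

(** Forward, 0 <= s1 <= 2 (s1 + s2) squeezes s1, and s2 follows by difference. Backward, 1 - up (s1
    + s2) <= A <= 1. *)
Lemma affinity_cvg1 : (forall n, A n <= 1) ->
  A n @[n --> \oo] --> (1 : R) <->
  ((s1 n)%:E @[n --> \oo] --> 0%E) /\ ((s2 n)%:E @[n --> \oo] --> 0%E).
Proof.
move=> A1; split=> [Al|[/fine_cvgP[_ c1] /fine_cvgP[_ c2]]].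
- have S0 : s1 n + s2 n @[n --> \oo] --> 0.
    apply/cvgr0Pnorm_lt => d d0.
    have d1 : expR (- (lo * d)) < 1.
      by rewrite -expR0 ltr_expR oppr_lt0 mulr_gt0.
    have nA : \forall n \near \oo, expR (- (lo * d)) < A n.
      exact: cvgr_gt Al _ d1.
    apply: filterS (filterI bounds nA) => n [[b1 _ b3] An].
    have := lt_le_trans An b3; rewrite ltr_expR ltrN2 ltr_pM2l//.
    by rewrite ger0_norm//; have := s10 n; lra.
  have c1 : s1 n @[n --> \oo] --> 0.
    apply: (@squeeze_cvgr _ _ _ _ (cst 0) (fun n => 2 * (s1 n + s2 n))).
    - by apply: filterS bounds => n [b1 _ _]; rewrite s10/=; lra.
    - exact: cvg_cst.
    - by rewrite -[X in _ --> X](mulr0 2); exact: cvgMr.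
  have c2 : s2 n @[n --> \oo] --> 0.
    rewrite (_ : s2 = fun n => (s1 n + s2 n) - s1 n); last first.
      by apply/funext => n; ring.
    by rewrite -[X in _ --> X](subr0 0); exact: cvgB.
  by split; apply: cvg_EFin => //; exact: nearW.
- apply: (@squeeze_cvgr _ _ _ _ (fun n => 1 - up * (s1 n + s2 n)) (cst 1)).
  + apply: filterS bounds => n [_ b2 _]; rewrite A1 andbT.
    by apply: le_trans b2; have := expR_ge1Dx (- (up * (s1 n + s2 n))).
  + rewrite -[X in _ --> X](subr0 1) -(mulr0 up) -(addr0 0).
    by apply: cvgB; [exact: cvg_cst|apply: cvgMr; exact: cvgD].
  + exact: cvg_cst.
Qed.

End limits.

(* "I1 or I2 tends to infinity" is read pointwise in n, that is, as
   max(I1, I2) --> +oo; with a disjunction of two limits, (a) would fail when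
   the two sums take turns in being large. *)
Theorem theorem2p1 (R : realType) (k : nat -> nat)
    (d : forall n, 'I_(k n) -> measure_display)
    (T : forall n (i : 'I_(k n)), measurableType (d n i))
    (P mu : forall n (i : 'I_(k n)), probability (T n i) R)
    (eps : forall n, 'I_(k n) -> {i01 R}) (tau : R)
    (k_cvg : k n @[n --> \oo] --> \oo)
    (mu_ac : forall n (i : 'I_(k n)), mu n i `<< P n i)
    (eps_cvg : \big[Num.max/0]_(i < k n) (eps n i)%:num @[n --> \oo] --> (0 : R))
    (tau_gt0 : 0 < tau) :
  (completely_detectable P mu eps <->
     maxe (signal1 P mu eps n tau) (signal2 P mu eps n tau)
       @[n --> \oo] --> +oo%E) /\
  (undetectable P mu eps <->
     (signal1 P mu eps n tau @[n --> \oo] --> 0%E) /\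
     (signal2 P mu eps n tau @[n --> \oo] --> 0%E)).
Proof.
pose L n (y : prod_space (T n)) : R := \prod_(i < k n)
  real_density (signal_marginal P mu eps i) (P n i) (y i).
have dens n : is_density (null P n) (alternative P mu eps n) (L n).
  apply: (@is_density_prod R (k n) _ (T n) (P n)
    (fun i => signal_marginal P mu eps i)
    (fun i => real_density (signal_marginal P mu eps i) (P n i))) => i.
  exact/is_density_real_density/mixture_dominates.
have testE n c : [set y | (c%:E < log_likelihood_ratio P mu eps y)%E] =
    [set y | expR c < L n y].
  apply/seteqP; split=> y /=; rewrite /log_likelihood_ratio lt_sum_lne//;
    by move=> i; exact/density_fin_num/mixture_dominates.
have [A] := choice (fun n => affinity_product eps (mu_ac n) tau_gt0).
move=> /choice[s1] /choice[s2] H.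
have LA n : has_mean (null P n) (fun y => Num.sqrt (L n y)) (A n).
  by case: (H n).
have s1E n : signal1 P mu eps n tau = (s1 n)%:E by case: (H n).
have s2E n : signal2 P mu eps n tau = (s2 n)%:E by case: (H n).
rewrite (_ : (fun n => maxe _ _) = fun n => maxe (s1 n)%:E (s2 n)%:E); last first.
  by apply/funext => n; rewrite s1E s2E.
rewrite (funext s1E) (funext s2E).
have s10 n : 0 <= s1 n by case: (H n).
have up0 : 0 < upper_rate tau by rewrite addr_gt0// divr_gt0.
have lo0 : 0 < lower_rate tau.
  by rewrite divr_gt0// mulr_gt0// exprn_gt0// addr_gt0.
have bounds : \forall n \near \oo, [/\ - (s1 n / 2) <= s2 n,
    expR (- (upper_rate tau * (s1 n + s2 n))) <= A n &
    A n <= expR (- (lower_rate tau * (s1 n + s2 n)))].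
  have m0 : 0 < Num.min 4^-1 (tau / 2) by rewrite lt_min invr_gt0 ltr0n divr_gt0.
  have eps_lt : \forall n \near \oo,
      \big[Num.max/0]_(i < k n) (eps n i)%:num < Num.min 4^-1 (tau / 2).
    exact: cvgr_lt eps_cvg _ m0.
  apply: filterS eps_lt => n eps_lt; have [_ _ _ _] := H n; apply=> i.
  by apply: le_trans (ltW eps_lt); exact: le_bigmax.
have psi_meas n c : measurable_fun setT
    (\1_[set y | (c%:E < log_likelihood_ratio P mu eps y)%E] : prod_space (T n) -> R).
  by rewrite testE; exact: measurable_density_gt (dens n) _.
have A01 n : 0 <= A n <= 1.
  by rewrite (affinity_ge0 (LA n)) (affinity_le1 (dens n) (LA n)).
have fin_error n (psi : prod_space (T n) -> R) :
    measurable_fun setT psi -> (forall y, 0 <= psi y <= 1) ->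
    testing_error (null P n) (alternative P mu eps n) psi =
    (fine (testing_error (null P n) (alternative P mu eps n) psi))%:E.
  by move=> mpsi psi01; have [e [-> _]] := testing_errorE (dens n) mpsi psi01.
pose lr n : prod_space (T n) -> R :=
  \1_[set y | (0%:E < log_likelihood_ratio P mu eps y)%E].
have lr01 n c (y : prod_space (T n)) :
    0 <= (\1_[set y | (c%:E < log_likelihood_ratio P mu eps y)%E] y : R) <= 1.
  exact: indic01.
have lr_error n :
    fine (testing_error (null P n) (alternative P mu eps n) (lr n)) <= A n.
  apply: (likelihood_ratio_error (dens n) (LA n)).
  rewrite -expR0 -testE; exact: fin_error (psi_meas n 0) (lr01 n 0).
split.
- rewrite -(affinity_cvg0 lo0 up0 s10 bounds); split.
  (* Whatever the critical values, A^2 is at most twice the error. *)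
  + move=> [c /fine_cvgP[_ /= e0]]; apply: sqr_cvg0.
    apply: (@squeeze_cvgr _ _ _ _ (cst 0) (fun n => 2 *
      fine (testing_error (null P n) (alternative P mu eps n)
        \1_[set y | ((c n)%:E < log_likelihood_ratio P mu eps y)%E]))).
    * apply: nearW => n; rewrite sqr_ge0/=.
      apply: (sqr_affinity_le (dens n) (LA n) (psi_meas n (c n)) (lr01 n (c n))).
      exact: fin_error (psi_meas n (c n)) (lr01 n (c n)).
    * exact: cvg_cst.
    * by rewrite -[X in _ --> X](mulr0 2); exact: cvgMr.
  (* The critical value 0 gives the test L > 1, whose error is at most A. *)
  + move=> A0; exists (cst 0); apply: cvg_EFin.
      apply: nearW => n.
      by rewrite (fin_error _ _ (psi_meas n 0) (lr01 n 0)).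
    apply: (@squeeze_cvgr _ _ _ _ (cst 0) A) => //; last exact: cvg_cst.
    apply: nearW => n; apply/andP; split; last exact: lr_error.
    apply: (testing_error_ge0 (dens n) (psi_meas n 0) (lr01 n 0)).
    exact: fin_error (psi_meas n 0) (lr01 n 0).
- rewrite -(affinity_cvg1 lo0 s10 bounds); last by move=> n; case/andP: (A01 n).
  split.
  (* It suffices to test undetectability on L > 1: its error tends to 1 and lies below A <= 1. *)
  + move=> /(_ lr (fun n => psi_meas n 0) (fun n => lr01 n 0)).
    move=> /fine_cvgP[_ /= e1].
    apply: (@squeeze_cvgr _ _ _ _ (fun n =>
      fine (testing_error (null P n) (alternative P mu eps n) (lr n))) (cst 1)).
    * by apply: nearW => n; rewrite lr_error; case/andP: (A01 n).
    * exact: e1.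
    * exact: cvg_cst.
  + move=> A1 psi mpsi psi01; apply: cvg_EFin.
      by apply: nearW => n; rewrite (fin_error _ _ (mpsi n) (psi01 n)).
    apply/subr_cvg0/sqr_cvg0.
    apply: (@squeeze_cvgr _ _ _ _ (cst 0) (fun n => 8 * (1 - A n))).
    * apply: nearW => n; rewrite sqr_ge0/= -sqrrN opprB.
      apply: (testing_error_near1 (dens n) (LA n) (mpsi n) (psi01 n)).
      exact: fin_error (mpsi n) (psi01 n).
    * exact: cvg_cst.
    * rewrite -[X in _ --> X](mulr0 8) -(subrr 1).
      by apply: cvgMr; apply: cvgB => //; exact: cvg_cst.
Qed.
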